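(* Let $k$ be a subfield of a field $f$ and let $G$ be a subgroup of $f^*$ such that: $k^*\le G$; $G/k^*$ is torsion; if $G/k^*$ has an element of order $4$, then $k$ contains a primitive $4$-th root of $1$; for every prime $p\in \pi(t(G))\cap\pi(G/k^* )$ the field $k$ contains a primitive $p$-th root of $1$; and $\operatorname{char}k\notin\pi(G/k^* )$. Then $k(G)=k\otimes_{kk^*}kG=\bigoplus_{t\in T}kt$, where $T$ is a transversal to $k^*$ in $G$; that is, the elements of $T$ are linearly independent over $k$ and span $k(G)$ as a $k$-vector space.
   Context: $f^*$ is the multiplicative group of $f$; $t(A)$ is the torsion subgroup of an abelian group $A$; $\pi(X)$ is the set of primes dividing orders of elements of a torsion group $X$; $k(S)$ is the subfield generated by $k$ and $S$. $kG$ denotes the group algebra; $k(G)$ is regarded as a $kG$-module and $k$ as a $kk^*$-module via multiplication. *)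

(* Defs.v *)
(* Subsets of the field f are Prop-valued predicates f -> Prop,
   since k, G and k(G) may be infinite. *)
From mathcomp Require Import all_boot all_order all_algebra.
Set Implicit Arguments. Unset Strict Implicit. Unset Printing Implicit Defensive.
Import GRing.Theory.
Local Open Scope ring_scope.

Definition is_subfield (f : fieldType) (k : f -> Prop) : Prop :=
  [/\ k 0, k 1, (forall x y, k x -> k y -> k (x - y)),
      (forall x y, k x -> k y -> k (x * y)) & (forall x, k x -> k x^-1)].

Definition is_subgroup_units (f : fieldType) (G : f -> Prop) : Prop :=
  [/\ G 1, (forall x, G x -> x != 0),
      (forall x y, G x -> G y -> G (x * y)) & (forall x, G x -> G x^-1)].

Definition gen_field (f : fieldType) (k G : f -> Prop) (x : f) : Prop :=
  forall L : f -> Prop, is_subfield L -> (forall y, k y -> L y) ->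
    (forall g, G g -> L g) -> L x.

Definition coset_order (f : fieldType) (k : f -> Prop) (g : f) (n : nat) : Prop :=
  [/\ (0 < n)%N, k (g ^+ n) & forall m, (0 < m < n)%N -> ~ k (g ^+ m)].

Definition quot_torsion (f : fieldType) (k G : f -> Prop) : Prop :=
  forall g, G g -> exists n, (0 < n)%N /\ k (g ^+ n).

Definition pi_quot (f : fieldType) (k G : f -> Prop) (p : nat) : Prop :=
  prime p /\ exists g n, [/\ G g, coset_order k g n & (p %| n)%N].

Definition pi_tors (f : fieldType) (G : f -> Prop) (p : nat) : Prop :=
  prime p /\ exists g n, [/\ G g, n.-primitive_root g & (p %| n)%N].

Definition kstar_transversal (f : fieldType) (k G T : f -> Prop) : Prop :=
  (forall t, T t -> G t) /\
  (forall g, G g -> exists t, [/\ T t, k (g / t) &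
                    forall t', T t' -> k (g / t') -> t' = t]).

Definition k_lin_indep (f : fieldType) (k T : f -> Prop) : Prop :=
  forall (s : seq f) (c : f -> f), uniq s -> (forall t, t \in s -> T t) ->
    (forall t, k (c t)) -> \sum_(t <- s) c t * t = 0 ->
    forall t, t \in s -> c t = 0.

Definition k_span (f : fieldType) (k T : f -> Prop) (x : f) : Prop :=
  exists (s : seq f) (c : f -> f), [/\ forall t, t \in s -> T t,
    forall t, k (c t) & x = \sum_(t <- s) c t * t].

(* Main.v *)
(* Induct on the orders modulo [k] of the elements of [G] in a putative
   relation.  Choose [a] in [G], outside [k], with [a ^+ p] in [k] for a prime
   [p]; the conditions force [X^p - a^p] to be irreducible.  The norm and the
   trace of [k(a)] over [k] show that the elements of [G] in [k(a)] are
   monomials [c a^j], and that Kneser's conditions pass to [k(a)] and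
   [G k(a)^*].  By induction the part of the relation outside [k(a)] vanishes;
   the remaining part lies in the span of the [a^j] with [j] prime to [p], which
   meets [k] only in [0]. *)
Require Import Defs.
From HB Require Import structures.
From mathcomp Require Import all_boot all_order all_algebra.
From mathcomp Require Import boolp zify ring.
Set Implicit Arguments. Unset Strict Implicit. Unset Printing Implicit Defensive.
Import GRing.Theory.
Local Open Scope ring_scope.

(** * Simple radical extensions *)

(** By Bezout [u * m = v * n + 1], and [y ^+ u / x ^+ v] is the required root. Applied to
    determinants, this turns norm identities into powers in [K]. *)
Lemma exp_coprime_root (K : fieldType) (x y : K) (m n : nat) :
  coprime m n -> x ^+ m = y ^+ n -> exists z, y = z ^+ m.
Proof.
case: (posnP m) => [->|m_gt0] co_mn xy.
  move: co_mn; rewrite /coprime gcd0n => /eqP n1; exists 1.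
  by move: xy; rewrite n1 !expr0 expr1.
have [->|y0] := eqVneq y 0; first by exists 0; rewrite expr0n eqn0Ngt m_gt0.
have [u v uv _] := egcdnP n m_gt0.
have y_v : y ^+ (v * n) = (x ^+ v) ^+ m by rewrite mulnC exprM -xy -!exprM mulnC.
exists (y ^+ u / x ^+ v); rewrite expr_div_n -y_v -exprM uv (eqP co_mn).
by rewrite exprD expr1 mulrAC mulfV ?expf_neq0 ?mul1r.
Qed.

Lemma companion_exists (K : fieldType) (d : nat) (h : {poly K}) :
  h \is monic -> size h = d.+2 -> exists A : 'M[K]_d.+1, char_poly A = h.
Proof.
move=> h_monic szh; move: (companionmx h) (companionmxK h_monic).
by rewrite szh => A; exists A.
Qed.

Lemma detX (K : fieldType) (n m : nat) (A : 'M[K]_n.+1) :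
  \det (A ^+ m) = \det A ^+ m.
Proof.
elim: m => [|m IHm]; first by rewrite !expr0 det1.
by rewrite !exprS detM IHm.
Qed.

Lemma horner_mx_comp (K : fieldType) (n : nat) (A : 'M[K]_n.+1) (P Q : {poly K}) :
  horner_mx A (P \Po Q) = horner_mx (horner_mx A Q) P.
Proof.
elim/poly_ind: P => [|P c IHP]; first by rewrite comp_poly0 !rmorph0.
rewrite comp_poly_MXaddC !rmorphD !rmorphM /= IHP.
by rewrite !horner_mx_C horner_mx_X.
Qed.

Section Radical.

Variables (K f : fieldType) (iota : {rmorphism K -> f}) (d : nat).
Local Notation p := d.+1.
Hypothesis p_pr : prime p.

Local Notation radpoly e := ('X^p - e%:P).

(** The companion matrix [A] of a proper monic factor of degree $m$ satisfies $A^p = e$.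
    Determinants give $\det(A)^p = e^m$ with $m$ prime to $p$, so [e] would be a $p$-th power. *)
Lemma irreducible_radical (e : K) :
  (forall c, c ^+ p <> e) -> irreducible_poly (radpoly e).
Proof.
move=> e_npow.
have szXe : size (radpoly e) = p.+1 by rewrite size_XnsubC.
split=> [|q szq q_dvd]; first by rewrite szXe ltnS prime_gt0.
rewrite -dvdp_size_eqp // szXe.
have Xe0 : radpoly e != 0 by rewrite -size_poly_eq0 szXe.
have q0 : q != 0 by apply: contraNneq Xe0 => q0; move: q_dvd; rewrite q0 dvd0p.
pose h := (lead_coef q)^-1 *: q.
have c0 : (lead_coef q)^-1 != 0 by rewrite invr_eq0 lead_coef_eq0.
have h_monic : h \is monic by rewrite monicE lead_coefZ mulVf ?lead_coef_eq0.
have h_dvd : h %| radpoly e by rewrite dvdpZl.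
have szh : size h = size q by rewrite size_scale.
have := dvdp_leq Xe0 q_dvd; rewrite szXe -szh.
case sz: (size h) => [|[|n]].
- by move: sz; rewrite szh => /eqP; rewrite size_poly_eq0 (negPf q0).
- by move: szq; rewrite -szh sz.
have [A chA] := companion_exists h_monic sz.
rewrite ltnS leq_eqVlt => /orP[/eqP-> //| lt_np].
have /dvdpP[r Xe_rh] := h_dvd.
have: horner_mx A (radpoly e) = 0.
  by rewrite Xe_rh rmorphM /= -chA Cayley_Hamilton mulr0.
rewrite rmorphB /= rmorphXn /= horner_mx_X horner_mx_C => /eqP.
rewrite subr_eq0 => /eqP /(congr1 determinant); rewrite det_scalar detX.
case/exp_coprime_root => [|c ec]; last by case: (e_npow c).
by rewrite prime_coprime // gtnNdvd.
Qed.

Lemma radical_dvd (x : f) (e : K) (Q : {poly K}) :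
  x ^+ p = iota e -> (forall c, c ^+ p <> e) ->
  (map_poly iota Q).[x] = 0 <-> radpoly e %| Q.
Proof.
move=> xe e_npow; split=> [Qx0 | /dvdpP[r ->]]; last first.
  rewrite rmorphM hornerM rmorphB rmorphXn /= map_polyX map_polyC /= !hornerE.
  by rewrite xe subrr mulr0.
have irr := irreducible_radical e_npow.
case: (boolP (coprimep (radpoly e) Q)) => [|]; last first.
  move=> ncop; rewrite coprimep_def in ncop.
  have := irr.2 _ ncop (dvdp_gcdl _ Q).
  by move=> /eqp_dvdl <-; apply: dvdp_gcdr.
move=> /Bezout_eq1_coprimepP[[u v] /= uv1].
have := congr1 (fun P => (map_poly iota P).[x]) uv1.
rewrite rmorphD !rmorphM /= rmorphB rmorphXn /= map_polyX map_polyC /= rmorph1.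
rewrite !hornerE Qx0 xe subrr !mulr0 addr0 => /esym/eqP.
by rewrite oner_eq0.
Qed.

Variables (a : f) (e : K).
Hypotheses (ae : a ^+ p = iota e) (e_npow : forall c, c ^+ p <> e).
Variable A : 'M[K]_p.
Hypothesis chA : char_poly A = radpoly e.

Local Notation ev Q := ((map_poly iota Q).[a]).

(* [K(a)] is identified with [K[A]]; norms and traces are read off [A]. *)
Lemma horner_mx_radical (Q : {poly K}) : horner_mx A Q = 0 <-> ev Q = 0.
Proof.
rewrite (radical_dvd Q ae e_npow); split=> [QA0 | /dvdpP[r ->]]; last first.
  by rewrite rmorphM /= -chA Cayley_Hamilton mulr0.
case: (boolP (coprimep (radpoly e) Q)) => [|]; last first.
  move=> ncop; rewrite coprimep_def in ncop.
  have := (irreducible_radical e_npow).2 _ ncop (dvdp_gcdl _ Q).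
  by move=> /eqp_dvdl <-; apply: dvdp_gcdr.
move=> /Bezout_eq1_coprimepP[[u v] /= uv1].
have /esym/eqP := congr1 (horner_mx A) uv1.
rewrite rmorphD !rmorphM /= -chA Cayley_Hamilton QA0 !mulr0 addr0 rmorph1.
by rewrite oner_eq0.
Qed.

Lemma horner_mx_radical_eq (P Q : {poly K}) :
  ev P = ev Q -> horner_mx A P = horner_mx A Q.
Proof.
move=> PQ; apply/eqP; rewrite -subr_eq0 -rmorphB; apply/eqP.
by apply/horner_mx_radical; rewrite rmorphB /= hornerD hornerN PQ subrr.
Qed.

Lemma horner_mx_radicalX : A ^+ p = e%:M.
Proof.
rewrite -(horner_mx_C A) -{1}(horner_mx_X A) -rmorphXn.
apply: horner_mx_radical_eq.
by rewrite rmorphXn /= map_polyX map_polyC /= !hornerE.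
Qed.

(** The characteristic polynomial of [W] has degree $p$ and vanishes at [ev R], so it is $X^p - e'$.
    The trace is minus its coefficient of degree $p - 1$, which is zero because $p > 1$. *)
Lemma mxtrace_radical (R : {poly K}) (e' : K) :
  ev R ^+ p = iota e' -> (forall c, c ^+ p <> e') -> \tr (horner_mx A R) = 0.
Proof.
move=> we' e'_npow; set W := horner_mx A R.
have chW0 : (map_poly iota (char_poly W)).[ev R] = 0.
  rewrite -horner_comp -map_comp_poly; apply/horner_mx_radical.
  by rewrite horner_mx_comp Cayley_Hamilton.
have /dvdpP[r chWr] := (radical_dvd _ we' e'_npow).1 chW0.
have r1 : r = 1.
  have r0 : r != 0.
    apply: contraNneq (monic_neq0 (char_poly_monic W)) => r0.
    by rewrite chWr r0 mul0r.
  have := congr1 (fun P : {poly K} => size P) chWr; rewrite size_char_poly.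
  rewrite size_Mmonic ?monicXnsubC // size_XnsubC // addnS /= -[p.+1]add1n.
  move=> /addIn /esym/eqP/size_poly1P[c c0 rc]; rewrite rc.
  have := monicP (char_poly_monic W); rewrite chWr rc lead_coef_Mmonic ?monicXnsubC //.
  by rewrite lead_coefC => ->.
apply/eqP; rewrite -oppr_eq0 -char_poly_trace // chWr r1 mul1r.
have d0 : d != 0%N by apply: contraTneq p_pr => ->.
by rewrite coefB coefXn coefC /= (negPf d0) subr0 -eqSS ltn_eqF.
Qed.

(** Taking norms to [K], the $n$-th power of the norm of [ev Q] is $c^p$, with $n$ prime to $p$. *)
Lemma radical_coprime_power (Q : {poly K}) (n : nat) (c : K) :
  coprime n p -> ev Q ^+ n = iota c -> exists b, c = b ^+ n.
Proof.
move=> co_np Qc; apply: (@exp_coprime_root _ (\det (horner_mx A Q)) _ n p co_np).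
rewrite -detX -det_scalar -rmorphXn -(horner_mx_C A); congr (\det _).
by apply: horner_mx_radical_eq; rewrite rmorphXn map_polyC /= hornerC horner_exp.
Qed.

(** The norm of [a] is [(-1) ^+ d * e]. Taking norms and dividing by $c^p$ makes its $j$-th power a
    $p$-th power, with $j$ prime to $p$. *)
Lemma radical_power (Q : {poly K}) (c : K) (j : nat) :
  ev Q ^+ p = iota c * a ^+ j -> c != 0 -> ~~ (p %| j)%N ->
  exists b, (-1) ^+ d * e = b ^+ p.
Proof.
move=> Qc c0 pj; apply: (@exp_coprime_root _ (\det (horner_mx A Q) / c) _ p j).
  by rewrite prime_coprime.
have -> : (-1) ^+ d * e = \det A.
  apply: (@mulfI _ ((-1) ^+ p)); first by rewrite expf_neq0 ?oppr_eq0 ?oner_eq0.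
  rewrite -char_poly_det chA coefB coefXn coefC /= sub0r mulrA -exprD.
  by rewrite addSn exprS addnn -mul2n exprM sqrrN expr1n expr1n mulr1 mulN1r.
have QA : horner_mx A Q ^+ p = horner_mx A c%:P * A ^+ j.
  rewrite -{3}(horner_mx_X A) -!rmorphXn -rmorphM /=.
  apply: horner_mx_radical_eq.
  by rewrite rmorphXn rmorphM rmorphXn /= map_polyC map_polyX /= !hornerE Qc.
move/(congr1 determinant): QA; rewrite horner_mx_C detM !detX det_scalar => QA.
by rewrite expr_div_n QA mulrAC mulfV ?mul1r // expf_neq0.
Qed.

Lemma mxtrace_radicalX (n : nat) : ~~ (p %| n)%N -> \tr (A ^+ n) = 0.
Proof.
move=> pn; rewrite -[X in \tr (X ^+ n)](horner_mx_X A) -rmorphXn.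
apply: (@mxtrace_radical _ (e ^+ n)).
  by rewrite map_polyXn hornerXn -exprM mulnC exprM ae rmorphXn.
move=> b /(exp_coprime_root (y := e)) [|z ez]; last exact: (e_npow (esym ez)).
by rewrite prime_coprime.
Qed.

(** Otherwise [mxtrace_radical] would kill the trace of every $Q X^i$. Since $p \ne 0$ in [K], these
    traces determine the value of [Q] at [a], which would be zero. *)
Lemma radical_shift (Q : {poly K}) (c : K) :
  ev Q != 0 -> p%:R != 0 :> K -> ev Q ^+ p = iota c ->
  exists i b, (ev Q * a ^+ i) ^+ p = iota b ^+ p.
Proof.
move=> Q0 p0 Qc; apply: contrapT => noshift.
have e0 : e != 0.
  by apply: contra_notN (e_npow (c := 0)) => /eqP->; rewrite expr0n.
have trQ i : \tr (horner_mx A (Q * 'X^i)) = 0.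
  apply: (@mxtrace_radical _ (c * e ^+ i)).
    rewrite !rmorphM /= map_polyXn hornerM hornerXn exprMn Qc.
    by rewrite -exprM mulnC exprM ae rmorphXn.
  move=> b bc; apply: noshift; exists i, b.
  by rewrite exprMn Qc -exprM mulnC exprM ae -!rmorphXn -rmorphM bc.
have Qmod : ev (Q %% radpoly e) = ev Q.
  rewrite [in RHS](divp_eq Q (radpoly e)) rmorphD hornerD [X in _ = X + _](_ : _ = 0).
    by rewrite add0r.
  by apply/(radical_dvd _ ae e_npow)/dvdp_mull.
suff QX0 : Q %% radpoly e = 0 by move: Q0; rewrite -Qmod QX0 rmorph0 horner0 eqxx.
have szR : (size (Q %% radpoly e)%R <= p)%N.
  by rewrite -ltnS -(size_XnsubC e (ltn0Sn d)) ltn_modp -size_poly_eq0 size_XnsubC.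
have {}trQ i : \tr (horner_mx A ((Q %% radpoly e) * 'X^i)) = 0.
  rewrite -[RHS](trQ i); congr (\tr _); apply: horner_mx_radical_eq.
  by rewrite !rmorphM /= !hornerM Qmod.
move: (Q %% radpoly e) szR trQ => R szR trR; apply/polyP => j; rewrite coef0.
have [pj|jp] := leqP p j; first by rewrite nth_default // (leq_trans szR).
have [szj|jsz] := leqP (size R) j; first by rewrite nth_default.
(* Multiplying by $X^{p-j}$ isolates the coefficient of degree $j$: its term has trace $p e R_j$.
   For $i \ne j$ the exponent $i + p - j$ lies strictly between $0$ and $2p$ and is not $p$, so the
   trace is zero. *)
have := trR (p - j)%N; rewrite -{1}[R]coefK poly_def mulr_suml rmorph_sum raddf_sum /=.
have AE i : horner_mx A (R`_i *: 'X^i * 'X^(p - j)) = R`_i *: A ^+ (i + (p - j)).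
  by rewrite -scalerAl -exprD linearZ /= rmorphXn /= horner_mx_X.
rewrite (bigD1 (Ordinal jsz)) //= big1 => [|i ij]; last first.
  rewrite AE mxtraceZ mxtrace_radicalX ?mulr0 //.
  have ip : (i < p)%N := leq_trans (ltn_ord i) szR.
  apply: contra ij => /dvdnP[[|[|m]] im]; apply/eqP/val_inj => /=; nia.
rewrite addr0 AE mxtraceZ subnKC 1?ltnW // horner_mx_radicalX mxtrace_scalar.
by move=> /eqP; rewrite mulf_eq0 -mulr_natr mulf_eq0 (negPf e0) (negPf p0) !orbF => /eqP.
Qed.
End Radical.

(** * Subfields as predicates *)

Section SubfieldType.

Variables (f : fieldType) (k : f -> Prop).

(** The proof [hk] is a parameter so that the closure instance can be found from the predicate
    itself. *)
Definition subfield_pred (hk : is_subfield k) : {pred f} := fun x => `[< k x >].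

Variable hk : is_subfield k.

Lemma subfield_pred_divring_closed : divring_closed (subfield_pred hk).
Proof.
have [k0 k1 kB kM kV] := hk; rewrite /subfield_pred.
split=> [|x y /asboolP kx /asboolP ky|x y /asboolP kx /asboolP ky].
- exact/asboolP.
- by apply/asboolP; apply: kB.
- by apply/asboolP; apply: kM => //; apply: kV.
Qed.

HB.instance Definition _ := GRing.isDivringClosed.Build f (subfield_pred hk)
  subfield_pred_divring_closed.

Definition subfield_type := {x | x \in subfield_pred hk}.

HB.instance Definition _ := SubChoice.on subfield_type.
HB.instance Definition _ := [SubChoice_isSubUnitRing of subfield_type by <:].
HB.instance Definition _ := [SubNzRing_isSubComNzRing of subfield_type by <:].
HB.instance Definition _ := [SubComUnitRing_isSubIntegralDomain of subfield_type by <:].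
HB.instance Definition _ := [SubIntegralDomain_isSubField of subfield_type by <:].

(** A field type makes matrices and polynomials over [k] available. Applied to $k(a)$, it supplies
    the next base field of the induction. *)
Lemma subfield_rmorphism : exists (K : fieldType) (iota : {rmorphism K -> f}),
  forall x, k x <-> exists c, x = iota c.
Proof.
exists subfield_type, (\val : {rmorphism subfield_type -> f}) => x.
split=> [kx | [c ->]]; last by have /asboolP := valP c.
have kx' : x \in subfield_pred hk by apply/asboolP.
by exists (exist _ x kx').
Qed.

End SubfieldType.

Section SubfieldPowers.

Variables (f : fieldType) (k : f -> Prop).
Hypothesis hk : is_subfield k.

Lemma subfield_opp x : k x -> k (- x).
Proof. by case: hk => k0 _ kB _ _ kx; rewrite -sub0r; apply: kB. Qed.

Lemma subfield_add x y : k x -> k y -> k (x + y).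
Proof. by case: hk => _ _ kB _ _ kx /subfield_opp ky; rewrite -[y]opprK; apply: kB. Qed.

Lemma subfield_mul x y : k x -> k y -> k (x * y).
Proof. by case: hk => _ _ _ kM _; apply: kM. Qed.

Lemma subfield_div x y : k x -> k y -> k (x / y).
Proof. by case: hk => _ _ _ kM kV kx ky; apply: kM => //; apply: kV. Qed.

Lemma subfield_exp x n : k x -> k (x ^+ n).
Proof.
case: hk => _ k1 _ kM _ kx.
by elim: n => [|n IHn]; rewrite ?expr0 // exprS; apply: kM.
Qed.

Lemma subfield_sum (I : eqType) (s : seq I) (F : I -> f) :
  (forall i, i \in s -> k (F i)) -> k (\sum_(i <- s) F i).
Proof.
case: hk => k0 _ _ _ _ kF; rewrite big_seq.
by apply: big_ind => //; apply: subfield_add.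
Qed.

Lemma subfield_mulr x y : y != 0 -> k y -> k (x * y) -> k x.
Proof. by move=> y0 ky kxy; rewrite -[x](mulfK y0); apply: subfield_div. Qed.

Lemma subfield_exp_gcd x m n : (0 < m)%N ->
  x != 0 -> k (x ^+ m) -> k (x ^+ n) -> k (x ^+ gcdn m n).
Proof.
move=> m0 x0 km kn; have [u v uv _] := egcdnP n m0.
apply: (@subfield_mulr _ (x ^+ (v * n))); rewrite ?expf_neq0 //.
  by rewrite mulnC exprM; apply: subfield_exp.
by rewrite -exprD addnC -uv mulnC exprM; apply: subfield_exp.
Qed.

(** Prime factors are removed from the exponent until the power leaves [k]. The bound [m * q <= n]
    later makes the induction measure decrease. *)
Lemma prime_step x n : (0 < n)%N -> ~ k x -> k (x ^+ n) ->
  exists m q, [/\ prime q, (0 < m)%N, (m * q <= n)%N,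
    ~ k (x ^+ m) & k (x ^+ m ^+ q)].
Proof.
elim/ltn_ind: n => n IHn n0 kx kn.
have n1 : (1 < n)%N by case: n n0 kn {IHn} => [|[|n]] // _; rewrite expr1.
have q_pr := pdiv_prime n1; have /dvdnP[m nE] := pdiv_dvd n.
have m0 : (0 < m)%N by case: m nE => // n0'; rewrite n0' in n0.
have mn : (m < n)%N by rewrite nE ltn_Pmulr // prime_gt1.
have [km|nkm] := pselect (k (x ^+ m)); last first.
  by exists m, (pdiv n); rewrite -exprM -nE; split.
have [m' [q [q_pr' m'0 m'q nk kq]]] := IHn _ mn m0 kx km.
by exists m', q; split=> //; apply: leq_trans m'q (ltnW mn).
Qed.

End SubfieldPowers.

(** * Simple algebraic extensions *)

Definition in_range (K f : fieldType) (iota : {rmorphism K -> f}) (x : f) : Prop :=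
  exists c, x = iota c.

Lemma in_range_subfield (K f : fieldType) (iota : {rmorphism K -> f}) :
  is_subfield (in_range iota).
Proof.
split.
- by exists 0; rewrite rmorph0.
- by exists 1; rewrite rmorph1.
- by move=> _ _ [c ->] [c' ->]; exists (c - c'); rewrite rmorphB.
- by move=> _ _ [c ->] [c' ->]; exists (c * c'); rewrite rmorphM.
- by move=> _ [c ->]; exists c^-1; rewrite fmorphV.
Qed.

(** This is the ring $K[a]$, which is already the field $K(a)$ when [a] is algebraic. *)
Definition adjoin (K f : fieldType) (iota : {rmorphism K -> f}) (a x : f) : Prop :=
  exists Q, x = (map_poly iota Q).[a].

(** Factors $X$ are cancelled from an annihilating polynomial until its constant term $c$ is
    nonzero; then $P(x) x = -c$ exhibits the inverse. *)
Lemma algebraic_inv_poly (K f : fieldType) (iota : {rmorphism K -> f}) (x : f) :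
  algebraicOver iota x -> adjoin iota x x^-1.
Proof.
have [->|x0] := eqVneq x 0.
  by exists 0; rewrite rmorph0 horner0 invr0.
move=> [P P0 /rootP]; elim/poly_ind: P P0 => [|P c IHP]; first by rewrite eqxx.
move=> Pc0; rewrite rmorphD rmorphM /= map_polyX map_polyC /= !hornerE.
have [c0|c0] := eqVneq c 0.
  rewrite c0 rmorph0 addr0 => /eqP; rewrite mulf_eq0 (negPf x0) orbF => /eqP.
  by apply: IHP; apply: contraNneq Pc0 => P0; rewrite P0 c0 mul0r add0r.
move=> /eqP; rewrite addr_eq0 => /eqP PxE; exists (- c^-1 *: P).
rewrite map_polyZ hornerZ; apply: (mulIf x0); rewrite mulVf // -mulrA PxE.
by rewrite -rmorphN -rmorphM mulrNN mulVf // rmorph1.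
Qed.

Section Adjoin.

Variables (K f : fieldType) (iota : {rmorphism K -> f}) (a : f).
Hypothesis alg_a : algebraicOver iota a.

Lemma adjoin_in_range x : in_range iota x -> adjoin iota a x.
Proof. by move=> [c ->]; exists c%:P; rewrite map_polyC hornerC. Qed.

Lemma adjoin_gen : adjoin iota a a.
Proof. by exists 'X; rewrite map_polyX hornerX. Qed.

Lemma adjoin_subfield : is_subfield (adjoin iota a).
Proof.
split.
- by exists 0; rewrite rmorph0 horner0.
- by exists 1; rewrite rmorph1 hornerC.
- by move=> _ _ [P ->] [Q ->]; exists (P - Q); rewrite rmorphB hornerD hornerN.
- by move=> _ _ [P ->] [Q ->]; exists (P * Q); rewrite rmorphM hornerM.
move=> _ [P ->]; case: (@algebraic_inv_poly _ _ iota (map_poly iota P).[a]).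
  apply/integral_algebraic/integral_horner; last exact/integral_algebraic.
  by apply/integral_poly => i; rewrite coef_map; apply: integral_id.
by move=> Q ->; exists (Q \Po P); rewrite map_comp_poly horner_comp.
Qed.

End Adjoin.

(** * Adjoining a radical to a Kneser pair *)

Section SubgroupUnits.

Variables (f : fieldType) (G : f -> Prop).
Hypothesis hG : is_subgroup_units G.

Lemma subgroup_neq0 x : G x -> x != 0.
Proof. by case: hG => _ G0 _ _; apply: G0. Qed.

Lemma subgroup_mul x y : G x -> G y -> G (x * y).
Proof. by case: hG => _ _ GM _; apply: GM. Qed.

Lemma subgroup_div x y : G x -> G y -> G (x / y).
Proof. by case: hG => _ _ GM GV Gx Gy; apply/GM/GV. Qed.

Lemma subgroup_exp x n : G x -> G (x ^+ n).
Proof.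
case: hG => G1 _ GM _ Gx.
by elim: n => [|n IHn]; rewrite ?expr0 // exprS; apply: GM.
Qed.

End SubgroupUnits.

(* Kneser's conditions, in a form that passes from [K] to [K(a)] and from [G]
   to [G K(a)^*]. *)
Record kneser_pair (K f : fieldType) (iota : {rmorphism K -> f}) (G : f -> Prop) :
    Prop := KneserPair {
  kneser_group : is_subgroup_units G;
  kneser_base : forall c, c != 0 -> G (iota c);
  kneser_torsion : forall g, G g ->
    exists2 n, (0 < n)%N & in_range iota (g ^+ n);
  kneser_four : forall g r, G g -> ~ in_range iota (g ^+ 2) ->
    in_range iota (g ^+ (2 ^ r)) -> exists i : K, i ^+ 2 = -1;
  kneser_unity : forall q z, prime q -> G z -> z ^+ q = 1 -> in_range iota z;
  kneser_char : forall q g r, prime q -> G g -> ~ in_range iota g ->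
    in_range iota (g ^+ (q ^ r)) -> q%:R != 0 :> K }.

Lemma coprime_solve (m n j : nat) : (0 < m)%N -> (0 < n)%N -> coprime m n ->
  exists u, (n %| m * u + j)%N.
Proof.
move=> m0 n0 co_mn; have [u v uv _] := egcdnP n m0.
(* As $m u$ is $1$ modulo $n$, the factor [n.-1 * j] produces $-j$ modulo $n$ without
   subtraction. *)
exists (u * (n.-1 * j))%N; rewrite mulnA [(m * u)%N]mulnC uv (eqP co_mn).
apply/dvdnP; exists (v * (n.-1 * j) + j)%N; case: n n0 {co_mn uv} => //= n _; ring.
Qed.

Section KneserStep.

Variables (K f : fieldType) (iota : {rmorphism K -> f}) (G : f -> Prop).
Variables (d : nat) (a : f).
Local Notation p := d.+1.
Hypotheses (KG : kneser_pair iota G) (p_pr : prime p).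
Hypotheses (Ga : G a) (aK : ~ in_range iota a).
Variable e : K.
Hypothesis ae : a ^+ p = iota e.

Let hK := in_range_subfield iota.
Let hG := kneser_group KG.

Lemma kneser_a_neq0 : a != 0.
Proof. exact: subgroup_neq0 hG _ Ga. Qed.
Let a0 := kneser_a_neq0.

(** The quotient [g / iota c] is a $q$-th root of unity in [G], so it lies in [K]. *)
Lemma kneser_root g c q : prime q -> G g -> g ^+ q = iota c ^+ q -> in_range iota g.
Proof.
move=> q_pr Gg gc; have g0 := subgroup_neq0 hG Gg.
have c0 : c != 0.
  apply: contraNneq (expf_neq0 q g0) => c0.
  by rewrite gc c0 rmorph0 expr0n eqn0Ngt prime_gt0.
have ic0 : iota c != 0 by rewrite fmorph_eq0.
have : in_range iota (g / iota c).
  apply: (kneser_unity KG q_pr); last by rewrite expr_div_n gc mulfV // expf_neq0.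
  exact/(subgroup_div hG)/(kneser_base KG).
by move=> gcK; rewrite -[g](divfK ic0); apply: subfield_mul hK _ _ gcK _; exists c.
Qed.

Lemma kneser_e_npow c : c ^+ p <> e.
Proof.
move=> ce; apply: aK; apply: (kneser_root (c := c) p_pr Ga).
by rewrite ae -ce rmorphXn.
Qed.
Let e_npow := kneser_e_npow.

Lemma kneser_p_neq0 : p%:R != 0 :> K.
Proof.
by apply: (kneser_char KG (r := 1) p_pr Ga aK); rewrite expn1; exists e.
Qed.

Lemma kneser_matrix : exists A : 'M[K]_p, char_poly A = 'X^p - e%:P.
Proof. by apply: companion_exists; rewrite ?monicXnsubC // size_XnsubC. Qed.

Lemma kneser_algebraic : algebraicOver iota a.
Proof.
exists ('X^p - e%:P); first by rewrite monic_neq0 ?monicXnsubC.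
apply/rootP; rewrite rmorphB /= map_polyXn map_polyC /= hornerD hornerXn hornerN.
by rewrite hornerC ae subrr.
Qed.
Let hA := adjoin_subfield kneser_algebraic.

Lemma kneser_exp_range j : (p %| j)%N -> in_range iota (a ^+ j).
Proof.
by move=> /dvdnP[m ->]; rewrite mulnC exprM ae; exists (e ^+ m); rewrite rmorphXn.
Qed.

Lemma kneser_exp_nrange j : ~~ (p %| j)%N -> ~ in_range iota (a ^+ j).
Proof.
move=> pj aj; apply: aK; rewrite -[a]expr1.
have <- : gcdn p j = 1%N by apply/eqP; rewrite -/(coprime _ _) prime_coprime.
by apply: subfield_exp_gcd => //; exists e.
Qed.

Lemma kneser_monomial_shift b u :
  in_range iota (b * a ^+ u) -> exists c j, b = iota c * a ^+ j.
Proof.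
(* Here $a^{-u} = a^{du} / e^u$, because $d u + u = p u$. *)
move=> [c bc]; exists (c / e ^+ u), (d * u)%N.
have e0 : e != 0 by rewrite -(fmorph_eq0 iota) -ae expf_neq0.
have au0 : a ^+ u != 0 by rewrite expf_neq0.
apply: (mulIf au0); rewrite bc -mulrA -exprD addnC -mulSn exprM ae.
by rewrite -rmorphXn -rmorphM divfK // expf_neq0.
Qed.

Lemma kneser_adjoin_shift b u : adjoin iota a (b * a ^+ u) -> adjoin iota a b.
Proof.
move=> bA; apply: (subfield_mulr hA _ _ bA); first by rewrite expf_neq0.
exact/(subfield_exp hA)/adjoin_gen.
Qed.

(** Choosing $u$ with $p \mid q u + j$ puts $(y a^u)^q$ in [K]; the norm then makes it a $q$-th
    power there, as $q$ is prime to $p$. *)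
Lemma kneser_adjust q y c j : prime q -> q != p ->
  adjoin iota a y -> y ^+ q = iota c * a ^+ j ->
  exists u v, (y * a ^+ u) ^+ q = iota v ^+ q.
Proof.
move=> q_pr qp yA yq.
have co_qp : coprime q p by rewrite prime_coprime // dvdn_prime2.
have [u pu] := coprime_solve j (prime_gt0 q_pr) (ltn0Sn d) co_qp.
have [A chA] := kneser_matrix.
have [Q yQ] : adjoin iota a (y * a ^+ u).
  by apply: subfield_mul => //; apply/(subfield_exp hA)/adjoin_gen.
have [c' ajc] : in_range iota (a ^+ (q * u + j)) := kneser_exp_range pu.
have yuq : (y * a ^+ u) ^+ q = iota (c * c').
  by rewrite exprMn yq -exprM mulrAC -mulrA -exprD mulnC ajc rmorphM.
exists u; rewrite yuq; rewrite yQ in yuq.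
have [v ->] := radical_coprime_power p_pr ae e_npow chA co_qp yuq.
by exists v; rewrite rmorphXn.
Qed.

(** It suffices that some $(b a^u)^q$ is a $q$-th power in [K], for then $b a^u$ is in [K]. This
    comes from the norm if $q \ne p$ and from the trace if $q = p$ divides $j$. In the remaining
    case the norm would make [e] a $p$-th power. *)
Lemma kneser_monomial_root q b c j : prime q -> G b -> adjoin iota a b ->
  b ^+ q = iota c * a ^+ j -> exists c' j', b = iota c' * a ^+ j'.
Proof.
move=> q_pr Gb bA bq; have b0 := subgroup_neq0 hG Gb.
have Gau u : G (b * a ^+ u) by apply/(subgroup_mul hG)/(subgroup_exp hG).
have [qp|qp] := eqVneq q p; last first.
  have [u [v buv]] := kneser_adjust q_pr qp bA bq.
  exact/(@kneser_monomial_shift b u)/(kneser_root q_pr (Gau u) buv).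
subst q; have [A chA] := kneser_matrix.
have c0 : c != 0.
  apply: contraNneq (expf_neq0 p b0) => c0; by rewrite bq c0 rmorph0 mul0r.
have [Q bQ] := bA.
have [pj|pj] := boolP (p %| j)%N.
  have [c' jc'] := kneser_exp_range pj.
  have bp : b ^+ p = iota (c * c') by rewrite bq jc' rmorphM.
  rewrite bQ in bp b0.
  have [u [v buv]] := radical_shift p_pr ae e_npow chA b0 kneser_p_neq0 bp.
  apply/(@kneser_monomial_shift b u)/(kneser_root (c := v) p_pr (Gau u)).
  by rewrite bQ; exact: buv.
have bp := bq; rewrite bQ in bp.
have [y ye] := radical_power p_pr ae e_npow chA bp c0 pj; exfalso.
have [p2|p_odd] := even_prime p_pr; last first.
  have d_even : odd d = false by apply: negbTE.
  by apply: (e_npow (c := y)); rewrite -ye -signr_odd d_even mul1r.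
have d1 : d = 1%N by case: p2.
(* For $p = 2$ the norm only gives $-e = y^2$. But [b] has order $4$ modulo [K], so $-1$ is a square
   in [K] and $e = (iy)^2$. *)
have [i i2] : exists i : K, i ^+ 2 = -1.
  apply: (kneser_four KG (r := 2) Gb) => [b2|].
    apply: (kneser_exp_nrange pj); apply: (@subfield_mulr _ _ hK _ (iota c)).
    - by rewrite fmorph_eq0.
    - by exists c.
    by rewrite mulrC -bq p2.
  have b2 : b ^+ 2 = iota c * a ^+ j by rewrite -bq p2.
  have a2 : a ^+ 2 = iota e by rewrite -ae p2.
  rewrite -[(2 ^ 2)%N]/(2 * 2)%N exprM b2 exprMn -exprM mulnC exprM a2.
  by exists (c ^+ 2 * e ^+ j); rewrite rmorphM !rmorphXn.
apply: (e_npow (c := i * y)); rewrite exprMn -ye d1 i2; ring.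
Qed.

(** Induction on an exponent $n$ with $b^n$ in [K], passing from [b] to $b^q$ for a prime $q \mid
    n$. *)
Lemma kneser_monomial b : G b -> adjoin iota a b ->
  exists c j, b = iota c * a ^+ j.
Proof.
move=> Gb bA; have [n n0 bn] := kneser_torsion KG Gb.
elim/ltn_ind: n b Gb bA n0 bn => n IHn b Gb bA n0 bn.
have [n1|n1] := leqP n 1.
  have -> : b = b ^+ n by rewrite (_ : n = 1%N) ?expr1 //; lia.
  by have [c ->] := bn; exists c, 0%N; rewrite expr0 mulr1.
have q_pr := pdiv_prime n1; have /dvdnP[m nE] := pdiv_dvd n.
have m0 : (0 < m)%N by case: m nE => // n0'; rewrite n0' in n0.
have mn : (m < n)%N by rewrite nE ltn_Pmulr // prime_gt1.
have [|||c [j bq]] := IHn _ mn (b ^+ pdiv n) _ _ m0.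
- exact: subgroup_exp.
- exact: subfield_exp.
- by rewrite -exprM mulnC -nE.
exact: kneser_monomial_root bq.
Qed.

(** For odd $q$, [g] and $x^{-1}$ have the same $q$-th power, a monomial in [a]. Norm and trace
    apply to $x^{-1}$, which is known to lie in $K(a)$; the resulting shift is transferred to [g],
    where [kneser_root] applies. *)
Lemma kneser_step_unity q g x : prime q -> G g -> adjoin iota a x -> x != 0 ->
  (g * x) ^+ q = 1 -> adjoin iota a (g * x).
Proof.
move=> q_pr Gg xA x0 gxq.
have [q2|q_odd] := even_prime q_pr.
  move: gxq; rewrite q2 => /eqP; rewrite sqrf_eq1.
  have A1 : adjoin iota a 1 by case: hA.
  by case/orP => /eqP -> //; apply: subfield_opp.
have gqA : adjoin iota a (g ^+ q).
  rewrite (_ : g ^+ q = x^-1 ^+ q).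
    by apply: subfield_exp => //; case: hA => _ _ _ _; apply.
  by apply: (mulIf (expf_neq0 q x0)); rewrite -!exprMn gxq mulVf // expr1n.
have [c [j gq]] := kneser_monomial (subgroup_exp hG q Gg) gqA.
have xVA : adjoin iota a x^-1 by case: hA => _ _ _ _; apply.
have xVq : x^-1 ^+ q = iota c * a ^+ j.
  by rewrite -gq exprVn; apply: (mulIf (expf_neq0 q x0)); rewrite mulVf ?expf_neq0 // -exprMn.
have Gau u : G (g * a ^+ u) by apply/(subgroup_mul hG)/(subgroup_exp hG).
suff [u [v guv]] : exists u v, (x^-1 * a ^+ u) ^+ q = iota v ^+ q.
  apply: subfield_mul => //; apply: (@kneser_adjoin_shift g u).
  apply/adjoin_in_range/(kneser_root (c := v) q_pr (Gau u)).
  by rewrite -guv !exprMn gq xVq.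
have [qp|qp] := eqVneq q p; last exact: kneser_adjust xVA xVq.
subst q; have [A chA] := kneser_matrix.
have c0 : c != 0.
  by apply: contraNneq (expf_neq0 p (subgroup_neq0 hG Gg)) => c0; rewrite gq c0 rmorph0 mul0r.
have xV0 : x^-1 != 0 by rewrite invr_eq0.
have [Q xQ] := xVA; rewrite xQ in xVq xV0 *.
have [pj|pj] := boolP (p %| j)%N.
  have [c' jc'] := kneser_exp_range pj.
  rewrite jc' -rmorphM in xVq.
  by have := radical_shift p_pr ae e_npow chA xV0 kneser_p_neq0 xVq.
have [y ye] := radical_power p_pr ae e_npow chA xVq c0 pj.
have d_even : odd d = false by apply: negbTE.
by case: (e_npow (c := y)); rewrite -ye -signr_odd d_even mul1r.
Qed.

(** Every [t i] is a monomial whose exponent of [a] is prime to $p$, so the sum has trace zero. An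
    element $r$ of [K] has trace $p r$, and $p \ne 0$. *)
Lemma kneser_step_sum (I : eqType) (s : seq I) (c t : I -> f) :
  (forall i, i \in s -> in_range iota (c i)) ->
  (forall i, i \in s -> [/\ G (t i), adjoin iota a (t i) & ~ in_range iota (t i)]) ->
  in_range iota (\sum_(i <- s) c i * t i) -> \sum_(i <- s) c i * t i = 0.
Proof.
have [A chA] := kneser_matrix.
move=> cK tG [r sr].
have [R [RE trR]] : exists R, \sum_(i <- s) c i * t i = (map_poly iota R).[a] /\
    \tr (horner_mx A R) = 0.
  rewrite big_seq; apply: (big_ind (fun y => exists R, y = (map_poly iota R).[a] /\
      \tr (horner_mx A R) = 0)).
  - by exists 0; rewrite !rmorph0 horner0 raddf0.
  - move=> _ _ [P [-> trP]] [Q [-> trQ]]; exists (P + Q).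
    by rewrite !rmorphD /= hornerD mxtraceD trP trQ addr0.
  move=> i si; have [c' ->] := cK i si; have [Gt tA tK] := tG i si.
  have [c'' [j tE]] := kneser_monomial Gt tA.
  have pj : ~~ (p %| j)%N.
    apply: contra_notN tK => /kneser_exp_range aj.
    by rewrite tE; apply: subfield_mul => //; exists c''.
  exists ((c' * c'') *: 'X^j); rewrite map_polyZ map_polyXn hornerZ hornerXn.
  rewrite tE rmorphM mulrA linearZ /= rmorphXn /= horner_mx_X mxtraceZ.
  by rewrite (mxtrace_radicalX p_pr ae e_npow chA pj) mulr0.
rewrite sr; suff -> : r = 0 by rewrite rmorph0.
have Rr : (map_poly iota R).[a] = (map_poly iota r%:P).[a].
  by rewrite -RE sr map_polyC hornerC.
move: trR; rewrite (horner_mx_radical_eq p_pr ae e_npow chA Rr).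
rewrite horner_mx_C mxtrace_scalar -mulr_natr => /eqP.
by rewrite mulf_eq0 (negPf kneser_p_neq0) orbF => /eqP.
Qed.

(** Removing the part of the order prime to $q$ lets the conditions on [G], which speak of $q$-power
    orders modulo [K], be applied to any element. *)
Lemma kneser_primary q g : prime q -> G g ->
  exists m s, [/\ coprime q m, (0 < m)%N & in_range iota (g ^+ m ^+ (q ^ s))].
Proof.
move=> q_pr Gg; have [n n0 gn] := kneser_torsion KG Gg.
have [m co_qm nE] := pfactor_coprime q_pr n0.
exists m, (logn q n); rewrite -exprM -nE; split=> //.
by case: m nE {co_qm} => // n0'; rewrite n0' in n0.
Qed.

(** Whether a power of [g * x] lies in $K(a)$ depends on [g] alone. A prime-to-$q$ power of [g] has
    $q$-power order modulo [K], so the conditions over [K] apply to it. *)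
Lemma kneser_pair_adjoin (K' : fieldType) (iota' : {rmorphism K' -> f}) :
  (forall x, adjoin iota a x <-> in_range iota' x) ->
  kneser_pair iota'
    (fun y => exists g x, [/\ G g, adjoin iota a x, x != 0 & y = g * x]).
Proof.
move=> K'E; have [A0 A1 AB AM AV] := hA; have [G1 G0 GM GV] := hG.
have hKA x : in_range iota x -> adjoin iota a x by apply: adjoin_in_range.
have gyA g x n : adjoin iota a x -> x != 0 ->
    adjoin iota a ((g * x) ^+ n) <-> adjoin iota a (g ^+ n).
  move=> xA x0; rewrite exprMn; split=> [|gA]; last first.
    by apply: AM => //; apply: (subfield_exp hA).
  by apply: (subfield_mulr hA); [rewrite expf_neq0 | apply: (subfield_exp hA)].
split.
- split.
  + by exists 1, 1; rewrite oner_eq0 mulr1.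
  + by move=> _ [g [x [Gg xA x0 ->]]]; rewrite mulf_neq0 // G0.
  + move=> _ _ [g [x [Gg xA x0 ->]]] [g' [x' [Gg' xA' x0' ->]]].
    exists (g * g'), (x * x'); rewrite mulf_neq0 // mulrACA.
    by split=> //; [apply: GM | apply: AM].
  + move=> _ [g [x [Gg xA x0 ->]]]; exists g^-1, x^-1.
    by rewrite invr_eq0 x0 invfM; split=> //; [apply: GV | apply: AV].
- move=> c c0; exists 1, (iota' c); rewrite fmorph_eq0 mul1r; split=> //.
  by apply/K'E; exists c.
- move=> _ [g [x [Gg xA x0 ->]]]; have [n n0 gn] := kneser_torsion KG Gg.
  by exists n => //; apply/K'E/gyA => //; apply: hKA.
- move=> _ r [g [x [Gg xA x0 ->]]].
  rewrite -!K'E !gyA // => g2 gr.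
  have [m [s [co_2m m0 gms]]] := kneser_primary (isT : prime 2) Gg.
  have [|i i2] := kneser_four KG (subgroup_exp hG m Gg) _ gms.
    move=> /hKA; rewrite -exprM => g2m; apply: g2.
    case: r gr => [|r] gr.
      by rewrite expn0 expr1 in gr; apply: (subfield_exp hA).
    (* Since $m$ is odd, $g^{2m}$ and $g^{2^{r+1}}$ in $K(a)$ would force $g^2$ into $K(a)$. *)
    have <- : gcdn (m * 2) (2 ^ r.+1) = 2%N.
      move: co_2m; rewrite coprime_sym => co_m2.
      by rewrite expnSr -muln_gcdl (eqP (coprimeXr r co_m2)).
    by apply: (subfield_exp_gcd hA) => //; [rewrite muln_gt0 m0 | apply: G0].
  have /K'E[i' i'E] : adjoin iota a (iota i) by apply: hKA; exists i.
  exists i'; apply: (fmorph_inj iota').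
  by rewrite rmorphXn -i'E -rmorphXn i2 !rmorphN1.
- move=> q _ q_pr [g [x [Gg xA x0 ->]]] gxq; apply/K'E.
  exact: kneser_step_unity q_pr Gg xA x0 gxq.
- move=> q _ r q_pr [g [x [Gg xA x0 ->]]].
  rewrite -!K'E gyA // -[g * x]expr1 gyA // expr1 => gA gr.
  have [m [s [co_qm m0 gms]]] := kneser_primary q_pr Gg.
  have: q%:R != 0 :> K.
    apply: (kneser_char KG q_pr (subgroup_exp hG m Gg) _ gms) => /hKA gm.
    apply: gA; rewrite -[g]expr1 -(eqP (_ : coprime m (q ^ r))).
      by apply: (subfield_exp_gcd hA) => //; apply: G0.
    by apply: coprimeXr; rewrite coprime_sym.
  by rewrite -(fmorph_eq0 iota) rmorph_nat -(rmorph_nat iota') fmorph_eq0.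
Qed.

End KneserStep.

(** * Kneser's theorem *)

(** Induction on the sum of the exponents [n i], with the base field varying. A sum lying in the
    base field, rather than a zero sum, is assumed so that the terms in $K(a)$ can be moved to the
    other side. *)
Lemma kneser_relation_bounded (N : nat) (K f : fieldType)
  (iota : {rmorphism K -> f}) (G : f -> Prop) (I : eqType) (s : seq I)
  (c t : I -> f) (n : I -> nat) :
  kneser_pair iota G -> (forall i, i \in s -> in_range iota (c i)) ->
  (forall i, i \in s -> [/\ G (t i), ~ in_range iota (t i), (0 < n i)%N &
     in_range iota (t i ^+ n i)]) ->
  (\sum_(i <- s) n i < N)%N ->
  in_range iota (\sum_(i <- s) c i * t i) -> \sum_(i <- s) c i * t i = 0.
Proof.
elim: N K iota G s n => [//|N IHN] K iota G s n KG cK tG sN sumK.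
have [-> | [i0 si0]] : s = [::] \/ exists i, i \in s.
- by case: s {tG cK sN sumK} => [|i s]; [left | right; exists i; rewrite mem_head].
- by rewrite big_nil.
have hG := kneser_group KG.
have [Gt0 t0K n0 tn0] := tG _ si0.
have [m [q [q_pr m0 mq aK [e ae]]]] := prime_step n0 t0K tn0.
have Ga := subgroup_exp hG m Gt0; set a := t i0 ^+ m in aK ae Ga.
case: q q_pr mq ae => // d p_pr mq ae.
have hA := adjoin_subfield (kneser_algebraic ae).
have [K' [iota' K'E]] := subfield_rmorphism hA.
have K'A x : in_range iota x -> in_range iota' x.
  by move=> /(adjoin_in_range a)/K'E.
have KG' := kneser_pair_adjoin KG p_pr Ga aK ae K'E.
pose B i := `[< adjoin iota a (t i) >].
have sumB : in_range iota' (\sum_(i <- s | B i) c i * t i).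
  rewrite -big_filter; apply: (subfield_sum (in_range_subfield _)) => i.
  rewrite mem_filter => /andP[/asboolP tA si].
  by apply: (subfield_mul (in_range_subfield _)); [apply/K'A/cK | apply/K'E].
have sumNB : \sum_(i <- [seq i <- s | ~~ B i]) c i * t i = 0.
  (* Over $K(a)$ the exponent at [i0] may be lowered to [m], because $a = t_{i_0}^m$. *)
  apply: (IHN _ iota' _ _ (fun i => if i == i0 then m else n i) KG').
  - by move=> i; rewrite mem_filter => /andP[_ si]; apply/K'A/cK.
  - move=> i; rewrite mem_filter => /andP[/asboolPn tA si].
    have [Gt tK ni tn] := tG i si; split.
    + by exists (t i), 1; rewrite mulr1 oner_eq0; split=> //; case: hA.
    + by move=> /K'E.
    + by case: ifP.
    + case: eqP => [ii0|_]; last exact: K'A.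
      by rewrite ii0 -/a; apply/K'E; apply: adjoin_gen.
  - rewrite big_filter; apply: (@leq_ltn_trans (\sum_(i <- s) (if i == i0 then m else n i))).
      by rewrite [X in (_ <= X)%N](bigID (fun i => ~~ B i)) /= leq_addr.
    rewrite -ltnS; apply: leq_trans sN; rewrite ltnS.
    have mn : (m < n i0)%N by apply: leq_trans mq; rewrite ltn_Pmulr ?prime_gt1.
    (* The index [i0] may be repeated in [s]; one occurrence gives the strict decrease, and no other
       term grows. *)
    rewrite !(big_rem i0 si0) /= eqxx -addSn leq_add // leq_sum // => i _.
    by case: eqP => [->|//]; apply: ltnW.
  - have -> : \sum_(i <- [seq i <- s | ~~ B i]) c i * t i =
        \sum_(i <- s) c i * t i - \sum_(i <- s | B i) c i * t i.
      by rewrite big_filter [in RHS](bigID B) /= addrAC subrr add0r.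
    by case: (in_range_subfield iota') => _ _ rB _ _; apply: rB => //; apply: K'A.
(* Only the terms in $K(a)$ remain, and the trace disposes of them. *)
move: sumK; rewrite (bigID B) /= -[X in _ + X]big_filter sumNB addr0.
rewrite -big_filter; apply: (kneser_step_sum KG p_pr Ga aK ae) => i.
  by rewrite mem_filter => /andP[_ /cK].
by rewrite mem_filter => /andP[/asboolP tA /tG[Gt tK _ _]].
Qed.

Lemma kneser_relation (K f : fieldType) (iota : {rmorphism K -> f}) (G : f -> Prop)
  (I : eqType) (s : seq I) (c t : I -> f) :
  kneser_pair iota G -> (forall i, i \in s -> in_range iota (c i)) ->
  (forall i, i \in s -> G (t i) /\ ~ in_range iota (t i)) ->
  in_range iota (\sum_(i <- s) c i * t i) -> \sum_(i <- s) c i * t i = 0.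
Proof.
move=> KG cK tG; have /choice[n nP] : forall i, exists n, i \in s ->
    (0 < n)%N /\ in_range iota (t i ^+ n).
  move=> i; case: (boolP (i \in s)) => [si|]; last by exists 0%N.
  by have [n n0 tn]  := kneser_torsion KG (tG i si).1; exists n; split.
apply: (kneser_relation_bounded (n := n) KG cK _ (ltnSn _)) => i si.
by have [Gt tK] := tG i si; have [n0 tn] := nP i si; split.
Qed.

(** * The generated subfield as a linear span *)

Section PairSpan.

Variables (f : fieldType) (k S : f -> Prop).
Hypothesis hk : is_subfield k.

(** With lists of pairs, addition is concatenation and equal vectors need not be merged. *)
Definition pair_span (x : f) : Prop := exists l : seq (f * f),
  (forall u, u \in l -> k u.1 /\ S u.2) /\ x = \sum_(u <- l) u.1 * u.2.

Lemma pair_span0 : pair_span 0.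
Proof. by exists [::]; rewrite big_nil. Qed.

Lemma pair_span_add x y : pair_span x -> pair_span y -> pair_span (x + y).
Proof.
move=> [l [lP ->]] [l' [lP' ->]]; exists (l ++ l'); rewrite big_cat; split=> // u.
by rewrite mem_cat => /orP[/lP|/lP'].
Qed.

Lemma pair_span_term c s : k c -> S s -> pair_span (c * s).
Proof.
move=> kc Ss; exists [:: (c, s)]; rewrite big_seq1; split=> // u.
by rewrite inE => /eqP->.
Qed.

(* [k_span] attaches its coefficients to the elements of [S], so repeated
   second components are merged. *)
Lemma pair_span_k_span x : pair_span x -> k_span k S x.
Proof.
move=> [l [lP ->]]; have [k0 _ _ _ _] := hk.
exists (undup (map snd l)), (fun t => \sum_(u <- l | u.2 == t) u.1); split.
- by move=> t; rewrite mem_undup => /mapP[u /lP[_ Su] ->].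
- move=> t; rewrite -big_filter; apply: subfield_sum => // u.
  by rewrite mem_filter => /andP[_ /lP[]].
rewrite [RHS](eq_bigr (fun t => \sum_(u <- l | u.2 == t) u.1 * u.2)); last first.
  by move=> t _; rewrite mulr_suml; apply: eq_bigr => u /eqP ->.
rewrite (exchange_big_dep xpredT) //= big_seq [RHS]big_seq; apply: eq_bigr => u ul.
rewrite big_mkcond (bigD1_seq u.2) ?undup_uniq ?mem_undup ?map_f //= eqxx.
by rewrite big1 ?addr0 // => t /negPf tu; rewrite eq_sym tu.
Qed.

End PairSpan.

Section Generated.

Variables (K f : fieldType) (iota : {rmorphism K -> f}) (G : f -> Prop).
Hypotheses (hG : is_subgroup_units G).
Hypothesis tors : forall g, G g -> exists2 n, (0 < n)%N & in_range iota (g ^+ n).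

Let hK := in_range_subfield iota.
Local Notation spanG := (pair_span (in_range iota) G).

Lemma pair_span_mul x y : spanG x -> spanG y -> spanG (x * y).
Proof.
move=> [l [lP ->]] [l' [lP' ->]]; rewrite mulr_suml big_seq.
apply: big_ind => [||u /lP[ku Gu]]; [exact: pair_span0 | exact: pair_span_add |].
rewrite mulr_sumr big_seq.
apply: big_ind => [||v /lP'[kv Gv]]; [exact: pair_span0 | exact: pair_span_add |].
rewrite mulrACA; apply: pair_span_term; first exact: (subfield_mul hK).
exact: (subgroup_mul hG).
Qed.

Lemma pair_span_in_range x : in_range iota x -> spanG x.
Proof.
by move=> xK; rewrite -[x]mulr1; apply: pair_span_term => //; case: hG.
Qed.

Lemma pair_span_algebraic x : spanG x -> algebraicOver iota x.
Proof.
move=> [l [lP ->]]; rewrite big_seq.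
apply: big_ind => [||u /lP[[c ->] Gu]]; [exact: algebraic0 | exact: algebraic_add |].
apply: algebraic_mul; first exact: algebraic_id.
have [n n0 [e ue]] := tors Gu; exists ('X^n - e%:P).
  by rewrite monic_neq0 ?monicXnsubC.
apply/rootP; rewrite rmorphB /= map_polyXn map_polyC /= hornerD hornerXn hornerN.
by rewrite hornerC ue subrr.
Qed.

(** Torsion makes each element of the span algebraic over [K], so its inverse is a polynomial in it
    and stays in this ring. *)
Lemma pair_span_subfield : is_subfield spanG.
Proof.
split.
- exact: pair_span0.
- by apply: pair_span_in_range; exists 1; rewrite rmorph1.
- move=> x y sx sy; rewrite -[y]mul1r -mulNr; apply: pair_span_add => //.
  apply: pair_span_mul => //; apply: pair_span_in_range.
  by exists (-1); rewrite rmorphN1.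
- exact: pair_span_mul.
- move=> x sx; have [Q ->] := algebraic_inv_poly (pair_span_algebraic sx).
  elim/poly_ind: Q => [|Q c IHQ]; first by rewrite rmorph0 horner0; apply: pair_span0.
  rewrite rmorphD rmorphM /= map_polyX map_polyC /= !hornerE.
  apply: pair_span_add; first exact: pair_span_mul.
  by apply: pair_span_in_range; exists c.
Qed.

End Generated.

(** * From the hypotheses of the theorem to a Kneser pair *)

Section Conditions.

Variables (f : fieldType) (k : f -> Prop).
Hypothesis hk : is_subfield k.

Lemma coset_order_prime x q :
  x != 0 -> prime q -> ~ k x -> k (x ^+ q) -> coset_order k x q.
Proof.
move=> x0 q_pr nkx kxq; split=> [||m /andP[m0 mq] kxm]; rewrite ?prime_gt0 //.
apply: nkx; rewrite -[x]expr1 -(eqP (_ : coprime q m)).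
  by apply: (subfield_exp_gcd hk) => //; apply: prime_gt0.
by rewrite prime_coprime // gtnNdvd.
Qed.

(** This finds the last of $x, x^q, x^{q^2}, \dots$ outside [k]; for prime $q$ and nonzero [x] it
    has order exactly $q$ modulo [k]. *)
Lemma power_chain x q r : ~ k x -> k (x ^+ (q ^ r)) ->
  exists s, ~ k (x ^+ (q ^ s)) /\ k (x ^+ (q ^ s) ^+ q).
Proof.
move=> nkx; elim: r => [|r IHr]; first by rewrite expn0 expr1.
have [/IHr//|nk] := pselect (k (x ^+ (q ^ r))).
by rewrite expnSr exprM; exists r.
Qed.

Lemma kneser_pair_of_conditions (K : fieldType) (iota : {rmorphism K -> f})
  (G : f -> Prop) :
  (forall x, k x <-> in_range iota x) ->
  is_subgroup_units G ->
  (forall x, k x -> x != 0 -> G x) ->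
  quot_torsion k G ->
  ((exists g, G g /\ coset_order k g 4) ->
     exists z, k z /\ 4.-primitive_root z) ->
  (forall p, pi_tors G p -> pi_quot k G p ->
     exists z, k z /\ p.-primitive_root z) ->
  (forall p, p \in [pchar f] -> ~ pi_quot k G p) ->
  kneser_pair iota G.
Proof.
move=> kE hG kG tors H4 Hp Hc; have [_ k1 _ _ _] := hk.
split=> //.
- by move=> c c0; apply: kG; [apply/kE; exists c | rewrite fmorph_eq0].
- by move=> g /tors[n [n0 /kE]]; exists n.
- move=> g r Gg; rewrite -!kE => nkg kgr.
  (* The chain is run from $g^2$, so that $h = g^{2^s}$ has $h^2$ outside [k] and $h^4$ in [k],
     hence order $4$ modulo [k]. *)
  have kgr2 : k (g ^+ 2 ^+ (2 ^ r)) by rewrite exprAC; apply: (subfield_exp hk).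
  have [s []] := power_chain nkg kgr2.
  rewrite exprAC; set h := g ^+ (2 ^ s) => nh2.
  rewrite -exprM => kh4; have Gh : G h by apply: (subgroup_exp hG).
  have [|z [kz z4]] := H4.
    exists h; split=> //; split=> // [[|[|[|[|m]]]]] // _ kh; apply: nh2.
    + by rewrite -[h]expr1; apply: (subfield_exp hk).
    + have: k (h ^+ gcdn 3 4).
        by apply: (subfield_exp_gcd hk) => //; apply: (subgroup_neq0 hG).
      exact: (subfield_exp hk).
  have /kE[i zi] := kz; exists i; apply: (fmorph_inj iota).
  rewrite rmorphN1 rmorphXn -zi; apply/eqP; rewrite -subr_eq0 opprK.
  have : (z ^+ 2 - 1) * (z ^+ 2 + 1) == 0.
    by rewrite -subr_sqr expr1n -exprM (prim_expr_order z4) subrr.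
  by rewrite mulf_eq0 subr_eq0 -(prim_order_dvd z4).
- move=> q z q_pr Gz zq; apply/kE; apply: contrapT => nkz.
  have [m zm mq] := prim_order_exists (prime_gt0 q_pr) zq.
  (* A [z] outside [k] puts $q$ in both sets of primes. Then [k] contains a primitive $q$-th root of
     $1$, of which [z] is a power. *)
  have zprim : q.-primitive_root z.
    have [_ /(_ _ mq)/orP[/eqP m1|/eqP <-//]] := primeP q_pr.
    by case: nkz; move: (prim_expr_order zm); rewrite m1 expr1 => ->.
  have [||y [ky yq]] := Hp q.
  + by split=> //; exists z, q.
  + split=> //; exists z, q; split=> //; apply: coset_order_prime => //.
      exact: (subgroup_neq0 hG).
    by rewrite zq.
  + by have [i zi] := prim_rootP yq zq; case: nkz; rewrite zi; apply: (subfield_exp hk).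
- move=> q g r q_pr Gg; rewrite -!kE => nkg kgr.
  have [s [nk ks]] := power_chain nkg kgr; set h := g ^+ (q ^ s) in nk ks.
  have Gh : G h by apply: (subgroup_exp hG).
  apply/negP => q0; apply: (Hc q).
    by rewrite inE q_pr -(rmorph_nat iota) fmorph_eq0.
  split=> //; exists h, q; split=> //; apply: coset_order_prime => //.
  exact: (subgroup_neq0 hG).
Qed.

End Conditions.

Theorem theorem1p3 (f : fieldType) (k G : f -> Prop) :
  is_subfield k ->
  is_subgroup_units G ->
  (forall x, k x -> x != 0 -> G x) ->
  quot_torsion k G ->
  ((exists g, G g /\ coset_order k g 4) ->
     exists z, k z /\ 4.-primitive_root z) ->
  (forall p, pi_tors G p -> pi_quot k G p ->
     exists z, k z /\ p.-primitive_root z) ->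
  (forall p, p \in [pchar f] -> ~ pi_quot k G p) ->
  forall T : f -> Prop, kstar_transversal k G T ->
    k_lin_indep k T /\ (forall x, gen_field k G x <-> k_span k T x).
Proof.
move=> hk hG kG tors H4 Hp Hc T [TG Ttr].
have [K [iota kE]] := subfield_rmorphism hk.
have KG := kneser_pair_of_conditions hk kE hG kG tors H4 Hp Hc.
have k1 : k 1 by case: hk.
split.
  move=> s c s_uniq sT kc sum0 t0 st0; apply/eqP; apply: contrapT => /negP ct0.
  have T_inj t : T t -> k (t / t0) -> t = t0.
    move=> Tt kt; have [u [_ _ uniq_u]] := Ttr _ (TG _ Tt).
    rewrite (uniq_u t0 (sT _ st0) kt); apply: uniq_u => //.
    by rewrite mulfV // (subgroup_neq0 hG (TG _ Tt)).
  have Gt0 : G t0 by apply/TG/sT.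
  have t00 := subgroup_neq0 hG Gt0.
  (* Dividing by the term at [t0] leaves ratios [t / t0] outside [k] whose combination is $-1$, an
     element of [k]; it must therefore be zero. *)
  have relE : \sum_(t <- rem t0 s) (c t / c t0) * (t / t0) = -1.
    apply: (mulIf (mulf_neq0 ct0 t00)); rewrite mulr_suml mulN1r.
    apply/eqP; rewrite -addr_eq0; apply/eqP.
    rewrite -[RHS]sum0 [RHS](big_rem t0 st0) /= addrC; congr (_ + _); apply: eq_bigr => t _.
    by rewrite mulrACA !divfK.
  have /eqP : \sum_(t <- rem t0 s) (c t / c t0) * (t / t0) = 0.
    apply: (kneser_relation KG).
    - by move=> t _; apply/kE/(subfield_div hk).
    - move=> t; rewrite mem_rem_uniq // inE => /andP[tt0 st].
      split; first by apply: (subgroup_div hG) => //; apply/TG/sT.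
      by move=> /kE /(T_inj _ (sT _ st)) tE; rewrite tE eqxx in tt0.
    - by rewrite relE; apply/kE/(subfield_opp hk).
  by rewrite relE oppr_eq0 oner_eq0.
move=> x; split=> [genx | [s [c [sT kc ->]]] L hL kL GL]; last first.
  by apply: (subfield_sum hL) => t /sT/TG/GL Lt; apply: (subfield_mul hL) => //; apply: kL.
apply: (pair_span_k_span hk).
(* The span of [G] is a subfield containing [k] and [G], so it contains the generated field. *)
have [l [lP ->]] : pair_span (in_range iota) G x.
  apply: genx; first exact: pair_span_subfield hG (kneser_torsion KG).
    by move=> y /kE; apply: pair_span_in_range.
  move=> g Gg; rewrite -[g]mul1r; apply: pair_span_term => //; exact/kE.
rewrite big_seq; apply: big_ind => [||u /lP[/kE ku Gu]].
- exact: pair_span0.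
- exact: pair_span_add.
(* Each element of [G] is replaced by its representative in [T], and the factor in [k] joins the
   coefficient. *)
have [t [Tt kut _]] := Ttr _ Gu; have t0 := subgroup_neq0 hG (TG _ Tt).
rewrite -[u.2](divfK t0) mulrA; apply: pair_span_term => //.
exact: (subfield_mul hk).
Qed.
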